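(* Let $f$, $M$ satisfy the standing assumptions (1)–(3) of the context, and suppose the penalty parameter satisfies $\beta>\tilde\beta$. Then every first-order stationary point $X\in\mathbb{R}^{n\times p}$ of $h$ (i.e. every $X$ with $\nabla h(X)=0$) satisfies $\sigma_{\max}(X^\top M X)\le 1$, i.e. $X\in\Omega:=\{X\in\mathbb{R}^{n\times p}:\sigma_{\max}(X^\top MX)\le 1\}$.
   Context: Let $1\le p\le n$ be integers, $f:\mathbb{R}^{n\times p}\to\mathbb{R}$ with $f(X)=\mathbb{E}_{\xi\sim\Xi}[f_\xi(X)]$, and $M=\mathbb{E}_{\theta\sim\Theta}[M_\theta]\in\mathbb{R}^{n\times n}$, where $\xi,\theta$ are random vectors with distributions $\Xi,\Theta$. Standing assumptions: (1) $f$ is differentiable and $\nabla f$ is globally $L_g$-Lipschitz continuous on $\mathbb{R}^{n\times p}$; (2) for almost every $\xi$, $f_\xi$ is differentiable, and $\mathbb{E}_{\xi\sim\Xi}[\nabla f_\xi(X)]=\nabla f(X)$ for all $X$; (3) $M$ is symmetric positive definite. Notation: $\|\cdot\|$ is the Frobenius norm, $\langle X,Y\rangle=\operatorname{tr}(X^\top Y)$; $\sigma_{\max}(\cdot),\sigma_{\min}(\cdot)$ are the largest and smallest singular values; $\kappa(M)=\sigma_{\max}(M)/\sigma_{\min}(M)$; $L_0:=\|\nabla f(0)\|$. Define $\mathcal{A}(X):=X\left(\tfrac32 I_p-\tfrac12X^\top MX\right)$ and, for a penalty parameter $\beta>0$, $$h(X):=f(\mathcal{A}(X))+\frac{\beta}{6}\operatorname{tr}\left(X^\top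 MX\left((X^\top MX)^2-3I_p\right)\right).$$ $\tilde\beta$ denotes a constant satisfying $$\tilde\beta\ge\frac{12\,\kappa(M)\left(3(p+1)L_g+\sigma_{\min}(M)^{1/2}L_0\right)}{\sigma_{\min}(M)}.$$ *)

(* Defs.v *)
From HB Require Import structures.
From mathcomp Require Import all_boot all_order all_algebra.
From mathcomp Require Import all_classical all_reals all_analysis.

Set Implicit Arguments.
Unset Strict Implicit.
Unset Printing Implicit Defensive.

Import Order.TTheory GRing.Theory Num.Theory.
Import numFieldNormedType.Exports.

Local Open Scope classical_set_scope.
Local Open Scope ring_scope.

(* The library's norm `|X| on matrices is the sup norm, so the Frobenius
   structure is introduced separately. Both norms are equivalent, hence they
   give the same Fréchet derivative 'd f X. *)
Definition frob_dot (R : realType) (n p : nat) (X Y : 'M[R]_(n, p)) : R :=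
  \tr (X^T *m Y).

Definition frob_norm (R : realType) (n p : nat) (X : 'M[R]_(n, p)) : R :=
  Num.sqrt (frob_dot X X).

(* Meaningful where f is differentiable: it is then the Riesz representative
   of 'd f X for frob_dot, see diff_grad. *)
Definition grad (R : realType) (n p : nat) (f : 'M[R]_(n, p) -> R)
    (X : 'M[R]_(n, p)) : 'M[R]_(n, p) :=
  \matrix_(i < n, j < p) 'd f X (delta_mx i j).

Lemma diff_grad (R : realType) (n p : nat) (f : 'M[R]_(n, p) -> R)
    (X D : 'M[R]_(n, p)) :
  'd f X D = frob_dot (grad f X) D.
Proof.
rewrite /frob_dot mxtrace_mulC [in LHS](matrix_sum_delta D) linear_sum /=.
apply: eq_bigr => i _; rewrite mxE linear_sum /=.
by apply: eq_bigr => j _; rewrite linearZ /= !mxE.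
Qed.

(* For a square matrix A the singular values are the nonnegative square roots
   of the eigenvalues of A^T A; they form a finite set, so sup and inf below
   are a maximum and a minimum as soon as n > 0. *)
Definition singular_values (R : realType) (n : nat) (A : 'M[R]_n) : set R :=
  [set s | 0 <= s /\ eigenvalue (A^T *m A) (s ^+ 2)].

Definition sigma_max (R : realType) (n : nat) (A : 'M[R]_n) : R :=
  sup (singular_values A).

Definition sigma_min (R : realType) (n : nat) (A : 'M[R]_n) : R :=
  inf (singular_values A).

Definition kappa (R : realType) (n : nat) (A : 'M[R]_n) : R :=
  sigma_max A / sigma_min A.

Definition sym_posdef (R : realType) (n : nat) (M : 'M[R]_n) : Prop :=
  M^T = M /\
  forall x : 'cV[R]_n, x != 0 -> 0 < (x^T *m M *m x) 0 0.

(* E_P[g] exists, is finite and equals v. Passing to an a.e. equal integrable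
   g' allows g to be arbitrary on a null set, as is needed for the gradient of
   f_xi, which is only defined for almost every xi. *)
Definition has_mean (d : measure_display) (T : measurableType d)
    (R : realType) (P : probability T R) (g : T -> R) (v : R) : Prop :=
  exists g' : T -> R,
    [/\ P.-integrable [set: T] (EFin \o g'),
        {ae P, forall w, g w = g' w} &
        ('E_P[g'] = v%:E)%E].

Definition has_mean_mx (d : measure_display) (T : measurableType d)
    (R : realType) (P : probability T R) (m n : nat)
    (G : T -> 'M[R]_(m, n)) (V : 'M[R]_(m, n)) : Prop :=
  forall i j, has_mean P (fun w => G w i j) (V i j).

Definition calA (R : realType) (n p : nat) (M : 'M[R]_n)
    (X : 'M[R]_(n, p)) : 'M[R]_(n, p) :=
  X *m ((3 / 2)%:M - (1 / 2) *: (X^T *m M *m X)).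

Definition penalty (R : realType) (n p : nat) (f : 'M[R]_(n, p) -> R)
    (M : 'M[R]_n) (beta : R) (X : 'M[R]_(n, p)) : R :=
  f (calA M X) +
  beta / 6 * \tr (X^T *m M *m X *m ((X^T *m M *m X) ^+ 2 - 3%:M)).

(* Main.v *)
Require Import Defs.
From HB Require Import structures.
From mathcomp Require Import all_boot all_order all_algebra.
From mathcomp Require Import all_classical all_reals all_analysis.
From mathcomp Require Import ring lra.

Set Implicit Arguments.
Unset Strict Implicit.
Unset Printing Implicit Defensive.

Import Order.TTheory GRing.Theory Num.Theory.
Import numFieldNormedType.Exports.

Local Open Scope classical_set_scope.
Local Open Scope ring_scope.

(** The idea is to move X only along its leading direction in the M-geometry.

    Let S = X^T M X, let a be the largest eigenvalue of S and v a unit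
    eigenvector for a, and put V = v^T v, the projector on v.  Along the curve
    X + t X V everything reduces to scalar polynomials in t
    ([gram_curve], [calA_curve], [trace_curve]): S changes by a multiple of V,
    A(X) moves on the line through A(X) with direction X V, and the trace of
    the penalty only sees the eigenvalue a (1 + t)^2.  Differentiating h at
    t = 0 turns stationarity into one scalar equation ([stationary_eigen])
      3/2 (1 - a) <G, X V> + beta (a^3 - a) = 0,    G = grad f (A(X)).
    If a > 1, division by a - 1 leaves
      beta a (a + 1) = 3/2 <G, X V>.

    The right-hand side cannot be that large.  With s = sigma_min M, the bound
    s I <= M gives s |X V|^2 <= tr (V S V) = a and
    s |X|^2 <= tr S <= p a ([gram_trace_ge], [mxtrace_le]), while
    |A(X)| <= 2 a |X| because 0 <= S <= a I ([calA_norm_le]).  As grad f is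
    Lg-Lipschitz, |G| <= L0 + 2 a Lg |X|, so both sides grow like a^2 and
    comparing them yields
      beta s <= 3/2 (sqrt s L0 + 2 p Lg)
    ([penalty_bound_of_growth]), against the lower bound on beta, since
    kappa M >= 1.

    The spectral facts come from the variational characterization of the
    extreme eigenvalues: a symmetric A attains its maximal value a on the unit
    sphere at some v, the form of a I - A is then nonnegative and vanishes at
    v, and Cauchy-Schwarz for that form makes v an eigenvector
    ([max_eigenvector]). *)

(** * The Frobenius inner product and positive semidefinite forms *)

Lemma frob_dotE (R : realType) (m n : nat) (X Y : 'M[R]_(m, n)) :
  frob_dot X Y = \sum_i \sum_j X i j * Y i j.
Proof.
rewrite /frob_dot /mxtrace exchange_big /=.
by apply: eq_bigr => j _; rewrite mxE; apply: eq_bigr => i _; rewrite mxE.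
Qed.

Lemma frob_dotC (R : realType) (m n : nat) (X Y : 'M[R]_(m, n)) :
  frob_dot X Y = frob_dot Y X.
Proof. by rewrite /frob_dot -mxtrace_tr trmx_mul trmxK. Qed.

Lemma frob_dotDr (R : realType) (m n : nat) (X Y Z : 'M[R]_(m, n)) :
  frob_dot X (Y + Z) = frob_dot X Y + frob_dot X Z.
Proof. by rewrite /frob_dot mulmxDr mxtraceD. Qed.

Lemma frob_dotZr (R : realType) (m n : nat) (a : R) (X Y : 'M[R]_(m, n)) :
  frob_dot X (a *: Y) = a * frob_dot X Y.
Proof. by rewrite /frob_dot -scalemxAr mxtraceZ. Qed.

Lemma frob_dotDl (R : realType) (m n : nat) (X Y Z : 'M[R]_(m, n)) :
  frob_dot (X + Y) Z = frob_dot X Z + frob_dot Y Z.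
Proof. by rewrite !(frob_dotC _ Z) frob_dotDr. Qed.

Lemma frob_dotZl (R : realType) (m n : nat) (a : R) (X Y : 'M[R]_(m, n)) :
  frob_dot (a *: X) Y = a * frob_dot X Y.
Proof. by rewrite !(frob_dotC _ Y) frob_dotZr. Qed.

Lemma frob_dot_mulmxr (R : realType) (m n k : nat) (X : 'M[R]_(m, n))
    (A : 'M[R]_(k, n)) (Y : 'M[R]_(m, k)) :
  frob_dot X (Y *m A) = frob_dot (X *m A^T) Y.
Proof. by rewrite /frob_dot trmx_mul trmxK mulmxA mxtrace_mulC mulmxA. Qed.

Lemma frob_dot_ge0 (R : realType) (m n : nat) (X : 'M[R]_(m, n)) :
  0 <= frob_dot X X.
Proof.
by rewrite frob_dotE; do 2!apply: sumr_ge0 => ? _; rewrite -expr2 sqr_ge0.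
Qed.

Lemma frob_dot_eq0 (R : realType) (m n : nat) (X : 'M[R]_(m, n)) :
  frob_dot X X = 0 -> X = 0.
Proof.
rewrite frob_dotE pair_big /= => /eqP.
rewrite psumr_eq0 => [/allP X0|[i j] _ /=]; last by rewrite -expr2 sqr_ge0.
apply/matrixP => i j; rewrite mxE; apply/eqP.
by move: (X0 (i, j) (mem_index_enum _)); rewrite /= mulf_eq0 orbb.
Qed.

Lemma frob_dot_gt0 (R : realType) (m n : nat) (X : 'M[R]_(m, n)) :
  X != 0 -> 0 < frob_dot X X.
Proof.
move=> X0; rewrite lt_def frob_dot_ge0 andbT.
by apply: contra_neq X0 => /frob_dot_eq0.
Qed.

Lemma sqr_frob_norm (R : realType) (m n : nat) (X : 'M[R]_(m, n)) :
  frob_norm X ^+ 2 = frob_dot X X.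
Proof. by rewrite /frob_norm sqr_sqrtr // frob_dot_ge0. Qed.

(** Reduces a quadratic form on matrices to the same form on their rows, so
    that inequalities between forms need only be checked on vectors. *)
Lemma frob_dot_rows (R : realType) (m n : nat) (X Y : 'M[R]_(m, n)) :
  frob_dot X Y = \sum_i frob_dot (row i X) (row i Y).
Proof.
rewrite frob_dotE; apply: eq_bigr => i _; rewrite frob_dotE big_ord1.
by apply: eq_bigr => j _; rewrite !mxE.
Qed.

Lemma frob_dot_rV (R : realType) (n : nat) (x y : 'rV[R]_n) :
  frob_dot x y = (x *m y^T) 0 0.
Proof. by rewrite frob_dotC /frob_dot mxtrace_mulC /mxtrace big_ord1. Qed.

(** Stated for row vectors acted on from the right, to match [eigenvalue]. *)
Definition psd (R : realType) (n : nat) (A : 'M[R]_n) : Prop :=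
  A^T = A /\ forall x : 'rV[R]_n, 0 <= frob_dot x (x *m A).

Lemma psd_mx (R : realType) (m n : nat) (A : 'M[R]_n) (X : 'M[R]_(m, n)) :
  psd A -> 0 <= frob_dot X (X *m A).
Proof.
by case=> _ A0; rewrite frob_dot_rows sumr_ge0 // => i _; rewrite row_mul.
Qed.

Lemma psd_form_le (R : realType) (m n : nat) (A B : 'M[R]_n)
    (X : 'M[R]_(m, n)) :
  psd (B - A) -> frob_dot X (X *m A) <= frob_dot X (X *m B).
Proof.
move=> /(psd_mx X).
by rewrite mulmxBr -scaleN1r frob_dotDr frob_dotZr mulN1r subr_ge0.
Qed.

Lemma psd_scalar_mx (R : realType) (n : nat) (a : R) :
  0 <= a -> psd (a%:M : 'M[R]_n).
Proof.
move=> a0; split=> [|x]; first exact: tr_scalar_mx.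
by rewrite mul_mx_scalar frob_dotZr mulr_ge0 // frob_dot_ge0.
Qed.

(** The discriminant of a nonnegative binary quadratic form is nonpositive.  The
    form of A may be degenerate; this is what [psd_ker] exploits. *)
Lemma psd_cauchy_schwarz (R : realType) (m n : nat) (A : 'M[R]_n)
    (X Y : 'M[R]_(m, n)) : psd A ->
  frob_dot X (Y *m A) ^+ 2 <=
  frob_dot X (X *m A) * frob_dot Y (Y *m A).
Proof.
move=> psdA; have [symA _] := psdA.
set a := frob_dot X _; set b := frob_dot X _; set c := frob_dot Y _.
have b0 : 0 <= b by exact: psd_mx.
have c0 : 0 <= c by exact: psd_mx.
have q s t : 0 <= s ^+ 2 * b + 2 * s * t * a + t ^+ 2 * c.
  have := psd_mx (s *: X + t *: Y) psdA.
  rewrite mulmxDl !frob_dotDr !frob_dotDl -!scalemxAl !frob_dotZr !frob_dotZl.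
  have -> : frob_dot Y (X *m A) = a by rewrite frob_dot_mulmxr symA frob_dotC.
  by rewrite -/a -/b -/c; congr (0 <= _); ring.
(* (c, - a) is the minimizing direction of the binary form when 0 < c, and
   (- a, b) plays that part when 0 < b. *)
have [c_gt0|c_le0] := ltP 0 c.
  have : 0 <= c * (b * c - a ^+ 2) by move: (q c (- a)); congr (0 <= _); ring.
  by rewrite pmulr_rge0 // subr_ge0.
have {c0 c_le0} c0 : c = 0 by apply/eqP; rewrite eq_le c0 c_le0.
have [b_gt0|b_le0] := ltP 0 b.
  have : 0 <= b * (b * c - a ^+ 2) by move: (q (- a) b); congr (0 <= _); ring.
  by rewrite pmulr_rge0 // subr_ge0.
have {b0 b_le0} b0 : b = 0 by apply/eqP; rewrite eq_le b0 b_le0.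
by have := q 1 (- a); rewrite b0 c0; nra.
Qed.

Lemma frob_cauchy_schwarz (R : realType) (m n : nat) (X Y : 'M[R]_(m, n)) :
  frob_dot X Y <= frob_norm X * frob_norm Y.
Proof.
have := psd_cauchy_schwarz X Y (psd_scalar_mx n (@ler01 R)).
rewrite !mulmx1 -!sqr_frob_norm -exprMn => XY.
apply: (le_trans (ler_norm _)).
rewrite -(ler_pXn2r (n := 2)) ?nnegrE ?mulr_ge0 ?sqrtr_ge0 //.
by rewrite real_normK ?num_real.
Qed.

Lemma frob_normD (R : realType) (m n : nat) (X Y : 'M[R]_(m, n)) :
  frob_norm (X + Y) <= frob_norm X + frob_norm Y.
Proof.
have X0 : 0 <= frob_norm X := sqrtr_ge0 _.
have Y0 : 0 <= frob_norm Y := sqrtr_ge0 _.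
rewrite -(ler_pXn2r (n := 2)) ?nnegrE ?addr_ge0 ?sqrtr_ge0 //.
rewrite sqr_frob_norm frob_dotDl !frob_dotDr -!sqr_frob_norm (frob_dotC Y X).
by have := frob_cauchy_schwarz X Y; nra.
Qed.

Lemma frob_normZ (R : realType) (m n : nat) (a : R) (X : 'M[R]_(m, n)) :
  frob_norm (a *: X) = `|a| * frob_norm X.
Proof.
rewrite /frob_norm frob_dotZl frob_dotZr mulrA -expr2.
by rewrite sqrtrM ?sqr_ge0 // sqrtr_sqr.
Qed.

(** A nonnegative form vanishes at X only if X is in its radical: apply
    Cauchy-Schwarz to X and X A. *)
Lemma psd_ker (R : realType) (m n : nat) (A : 'M[R]_n) (X : 'M[R]_(m, n)) :
  psd A -> frob_dot X (X *m A) = 0 -> X *m A = 0.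
Proof.
move=> psdA X0; apply: frob_dot_eq0.
have := psd_cauchy_schwarz (X *m A) X psdA; rewrite X0 mulr0 => h.
by apply/eqP; rewrite -sqrf_eq0 eq_le h sqr_ge0.
Qed.

(** The operator norm of A is controlled by its form.  Cauchy-Schwarz for the
    pair X A, X gives |X A|^4 <= <X A, X A A> <X, X A>, and each factor is at
    most a times a squared norm. *)
Lemma psd_mulmx_le (R : realType) (m n : nat) (A : 'M[R]_n) (a : R)
    (X : 'M[R]_(m, n)) : 0 <= a -> psd A -> psd (a%:M - A) ->
  frob_norm (X *m A) <= a * frob_norm X.
Proof.
move=> a0 psdA psdaA.
have form_le (Y : 'M[R]_(m, n)) :
    frob_dot Y (Y *m A) <= a * frob_norm Y ^+ 2.
  have := psd_form_le Y psdaA.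
  by rewrite mul_mx_scalar frob_dotZr sqr_frob_norm.
have := psd_cauchy_schwarz (X *m A) X psdA; rewrite -sqr_frob_norm.
have := form_le X; have := form_le (X *m A).
have := psd_mx X psdA; have := psd_mx (X *m A) psdA.
set u := frob_norm (X *m A); set v := frob_norm X.
have u0 : 0 <= u by exact: sqrtr_ge0.
have v0 : 0 <= v by exact: sqrtr_ge0.
move=> p0 q0 p_le q_le cs.
have : (u ^+ 2) ^+ 2 <= (a * u ^+ 2) * (a * v ^+ 2).
  by apply: (le_trans cs); exact: ler_pM.
have [->|u_neq0] := eqVneq u 0; first by rewrite mulr_ge0.
have u2_gt0 : 0 < u ^+ 2 by rewrite exprn_gt0 // lt_def u_neq0.
move=> h; rewrite -(ler_pXn2r (n := 2)) ?nnegrE ?mulr_ge0 //.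
by rewrite -(ler_pM2l u2_gt0); move: h; congr (_ <= _); ring.
Qed.

(** * Differentiability of matrix expressions *)

(** Matrix-valued maps are handled entrywise: F is the sum of its entries times
    the elementary matrices. *)
Lemma differentiable_mx (R : realType) (V : normedModType R) (m n : nat)
    (F : V -> 'M[R]_(m, n)) (x : V) :
  (forall i j, differentiable (fun y => F y i j) x) -> differentiable F x.
Proof.
move=> dF.
have -> : F = \sum_(i < m) \sum_(j < n) fun y => F y i j *: delta_mx i j.
  apply/funext => y; rewrite {1}(matrix_sum_delta (F y)) fct_sumE.
  by apply: eq_bigr => i _; rewrite fct_sumE.
by do 2!apply: differentiable_sum => ?; exact: differentiableZl.
Qed.

Lemma differentiable_entry (R : realType) (V : normedModType R) (m n : nat)
    (F : V -> 'M[R]_(m, n)) (x : V) i j :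
  differentiable F x -> differentiable (fun y => F y i j) x.
Proof.
move=> dF.
exact: (differentiable_comp (g := fun N : 'M[R]_(m, n) => N i j) dF
  (differentiable_coord _ _ _)).
Qed.

Lemma differentiable_mulmx (R : realType) (V : normedModType R) (m n p : nat)
    (F : V -> 'M[R]_(m, n)) (G : V -> 'M[R]_(n, p)) (x : V) :
  differentiable F x -> differentiable G x ->
  differentiable (fun y => F y *m G y) x.
Proof.
move=> dF dG; apply: differentiable_mx => i k.
rewrite (_ : (fun y => _) =
    \sum_(j < n) ((fun y => F y i j) * (fun y => G y j k))).
  by apply: differentiable_sum => j; apply: differentiableM;
    exact: differentiable_entry.
by apply/funext => y; rewrite mxE fct_sumE.
Qed.

Lemma differentiable_trmx (R : realType) (V : normedModType R) (m n : nat)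
    (F : V -> 'M[R]_(m, n)) (x : V) :
  differentiable F x -> differentiable (fun y => (F y)^T) x.
Proof.
move=> dF; apply: differentiable_mx => i j.
by under eq_fun do rewrite mxE; exact: differentiable_entry.
Qed.

Lemma differentiable_mxtrace (R : realType) (V : normedModType R) (n : nat)
    (F : V -> 'M[R]_n) (x : V) :
  differentiable F x -> differentiable (fun y => \tr (F y)) x.
Proof.
move=> dF; rewrite (_ : (fun y => _) = \sum_(i < n) (fun y => F y i i)).
  by apply: differentiable_sum => i; exact: differentiable_entry.
by apply/funext => y; rewrite fct_sumE.
Qed.

Lemma differentiable_form (R : realType) (m n : nat) (A : 'M[R]_n)
    (X : 'M[R]_(m, n)) :
  differentiable (fun Y : 'M[R]_(m, n) => frob_dot Y (Y *m A)) X.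
Proof.
apply: differentiable_mxtrace; apply: differentiable_mulmx.
  exact: differentiable_trmx.
by apply: differentiable_mulmx => //; exact: differentiable_cst.
Qed.

(** * Extreme eigenvalues and singular values *)

Lemma compact_sphere (R : realType) (n : nat) :
  compact [set v : 'rV[R]_n | frob_dot v v = 1].
Proof.
apply: bounded_closed_compact.
  exists 1; split=> [|a a1 v /= v1]; first exact: num_real.
  apply: le_trans (ltW a1); rewrite [leLHS]/Num.Def.normr /= mx_normrE.
  apply: bigmax_le => // -[i j] _ /=.
  rewrite -(ler_pXn2r (n := 2)) ?nnegrE // expr1n real_normK ?num_real //.
  rewrite -v1 frob_dotE (ord1 i) big_ord1 (bigD1 j) //= -expr2 lerDl.
  by apply: sumr_ge0 => k _; rewrite -expr2 sqr_ge0.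
rewrite (_ : mkset _ =
    (fun v : 'rV[R]_n => frob_dot v (v *m 1%:M)) @^-1` [set 1]).
  apply: closed_comp => [v _|]; last exact: closed_eq.
  exact/differentiable_continuous/differentiable_form.
by apply/funext => v /=; rewrite mulmx1.
Qed.

(** The maximum a of the Rayleigh quotient is attained by compactness of the
    sphere, at some v.  By homogeneity a I - A is positive semidefinite, and its
    form vanishes at v, so v lies in its kernel. *)
Lemma max_eigenvector (R : realType) (n : nat) (A : 'M[R]_n) :
  (0 < n)%N -> A^T = A ->
  exists a : R, exists v : 'rV[R]_n,
    [/\ v *m A = a *: v, frob_dot v v = 1 & psd (a%:M - A)].
Proof.
move=> n0 symA.
have sph0 : [set v : 'rV[R]_n | frob_dot v v = 1] !=set0.
  exists (delta_mx 0 (Ordinal n0)) => /=.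
  rewrite frob_dotE big_ord1 (bigD1 (Ordinal n0)) //= !mxE !eqxx mulr1.
  by rewrite big1 ?addr0 // => j /negPf j0; rewrite !mxE j0 andbF mulr0.
have cf : {within [set v : 'rV[R]_n | frob_dot v v = 1],
    continuous (fun v : 'rV[R]_n => frob_dot v (v *m A))}.
  apply: continuous_subspaceT => v.
  exact/differentiable_continuous/differentiable_form.
have [v] := EVT_max_rV sph0 (@compact_sphere R n) cf.
rewrite inE /= => v1 vmax; set a := frob_dot v (v *m A) in vmax.
have form (x : 'rV[R]_n) :
    frob_dot x (x *m (a%:M - A)) = a * frob_dot x x - frob_dot x (x *m A).
  rewrite mulmxBr mul_mx_scalar -scaleN1r.
  by rewrite frob_dotDr !frob_dotZr mulN1r.
have psdaA : psd (a%:M - A).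
  split=> [|x]; first by rewrite linearB /= tr_scalar_mx symA.
  have [->|x0] := eqVneq x 0; first by rewrite mul0mx frob_dot_ge0.
  have xx0 : 0 < frob_norm x by rewrite sqrtr_gt0 frob_dot_gt0.
  have := vmax ((frob_norm x)^-1 *: x).
  rewrite inE /= -scalemxAl !frob_dotZl !frob_dotZr form -sqr_frob_norm.
  rewrite !(mulrA _^-1) -expr2 exprVn mulVf ?expf_neq0 ?gt_eqF // => /(_ erefl).
  by rewrite ler_pdivrMl ?exprn_gt0 // mulrC subr_ge0.
exists a, v; split=> //; apply/eqP.
rewrite eq_sym -subr_eq0 -mul_mx_scalar -mulmxBr; apply/eqP.
by apply: psd_ker => //; rewrite form v1 mulr1 subrr.
Qed.

(** Singular values are defined through A^T A = A^2.  From v A^2 = s^2 v, the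
    vector w = v A - s v satisfies w A = - s w, which for positive semidefinite
    A forces w = 0. *)
Lemma singular_value_eigen (R : realType) (n : nat) (A : 'M[R]_n) (s : R) :
  psd A ->
  singular_values A s <->
    0 <= s /\ exists2 v : 'rV[R]_n, v *m A = s *: v & v != 0.
Proof.
move=> psdA; have [symA _] := psdA; rewrite /singular_values /= symA.
split=> -[s0 h]; split=> //.
  have {h} [v vA v0] := eigenvalueP h; exists v => //.
  apply/eqP; rewrite -subr_eq0; apply/eqP.
  set w := v *m A - s *: v.
  have wA : w *m A = - s *: w.
    rewrite /w mulmxBl -mulmxA vA -scalemxAl.
    by rewrite scaleNr scalerBr scalerA -expr2 opprB.
  have := psd_mx w psdA; rewrite wA frob_dotZr mulNr oppr_ge0 => sw.
  have [s_gt0|s_le0] := ltP 0 s.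
    apply: frob_dot_eq0; apply/eqP.
    by rewrite eq_le frob_dot_ge0 andbT -(pmulr_rle0 _ s_gt0).
  (* For s = 0 the form of A on w gives no information, but then
     |v A|^2 = <v A A, v> = 0. *)
  have s_eq0 : s = 0 by apply/eqP; rewrite eq_le s0 s_le0.
  rewrite /w s_eq0 scale0r subr0; apply: frob_dot_eq0.
  rewrite frob_dot_mulmxr symA -mulmxA vA s_eq0.
  by rewrite expr0n scale0r /frob_dot linear0 mul0mx mxtrace0.
case: h => v vA v0; apply/eigenvalueP; exists v => //.
by rewrite mulmxA vA -scalemxAl vA scalerA expr2.
Qed.

Lemma psd_eigenvalue_ge0 (R : realType) (n : nat) (A : 'M[R]_n) (a : R)
    (v : 'rV[R]_n) : psd A -> v *m A = a *: v -> v != 0 -> 0 <= a.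
Proof.
case=> _ /(_ v) + vA /frob_dot_gt0 v0.
by rewrite vA frob_dotZr pmulr_lge0.
Qed.

Lemma sym_posdef_psd (R : realType) (n : nat) (M : 'M[R]_n) :
  sym_posdef M -> psd M.
Proof.
case=> symM M0; split=> // x; have [->|x0] := eqVneq x 0.
  by rewrite mul0mx frob_dot_ge0.
have := M0 x^T; rewrite trmxK -trmx_eq0 trmxK => /(_ x0) /ltW.
by rewrite frob_dot_rV trmx_mul symM mulmxA.
Qed.

(** Applying [max_eigenvector] to - M produces the smallest eigenvalue of M,
    which is therefore the infimum defining [sigma_min]; applied to M, it bounds
    the singular values, so that the supremum in [kappa] is a genuine one. *)
Lemma sigma_min_posdef (R : realType) (n : nat) (M : 'M[R]_n) :
  (0 < n)%N -> sym_posdef M ->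
  [/\ 0 < sigma_min M, psd (M - (sigma_min M)%:M) & 1 <= kappa M].
Proof.
move=> n0 pdM; have psdM := sym_posdef_psd pdM; have [symM posM] := pdM.
have symNM : (- M)^T = - M by rewrite linearN /= symM.
have [a [v [vM v1 psdaM]]] := max_eigenvector n0 symNM.
have v0 : v != 0.
  apply: contra_eq_neq v1 => ->.
  by rewrite /frob_dot mulmx0 mxtrace0 eq_sym oner_eq0.
have {}vM : v *m M = - a *: v by rewrite scaleNr -vM mulmxN opprK.
have {}psdaM : psd (M - (- a)%:M).
  by rewrite -scalemx1 scaleNr opprK scalemx1 addrC -[M in _ + M]opprK.
have na0 : 0 < - a.
  have := posM v^T; rewrite trmxK -trmx_eq0 trmxK vM => /(_ v0).
  by rewrite -scalemxAl mxE -frob_dot_rV v1 mulr1.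
have [b [w [_ _ psdbM]]] := max_eigenvector n0 symM.
have sv_a : singular_values M (- a).
  by apply/(singular_value_eigen _ psdM); split; [exact: ltW|exists v].
have sv_ge s : singular_values M s -> - a <= s.
  move=> /(singular_value_eigen _ psdM)[_ [u uM u0]].
  rewrite -subr_ge0; apply: (psd_eigenvalue_ge0 psdaM _ u0).
  by rewrite mulmxBr uM mul_mx_scalar -scalerBl.
have sv_le s : singular_values M s -> s <= b.
  move=> /(singular_value_eigen _ psdM)[_ [u uM u0]].
  rewrite -subr_ge0; apply: (psd_eigenvalue_ge0 psdbM _ u0).
  by rewrite mulmxBr uM mul_mx_scalar -scalerBl.
have minE : sigma_min M = - a.
  apply/eqP; rewrite eq_le; apply/andP; split.
    by apply: ge_inf sv_a; exists (- a).
  by apply: lb_le_inf => //; exists (- a).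
rewrite minE; split=> //; rewrite /kappa minE ler_pdivlMr // mul1r.
by apply: ub_le_sup sv_a; exists b.
Qed.

(** * The penalty function along the leading eigendirection *)

(** The chain rule along a curve on a line through x; this covers both the
    line on which the penalty function is tested and the polynomial
    reparametrization of a line that [calA] makes out of it. *)
Lemma is_derive_curve (R : realType) (V W : normedModType R) (F : V -> W)
    (x d : V) (c : R -> R) (c' : R) :
  differentiable F x -> is_derive (0 : R) 1 c c' -> c 0 = 0 ->
  is_derive (0 : R) 1 (fun t => F (x + c t *: d)) (c' *: 'd F x d).
Proof.
move=> dF dc c0.
have difc : differentiable c 0 by apply/derivable1_diffP; case: dc.
pose g := cst x + (fun t => c t *: d).
have gx : g 0 = x by rewrite /g !fctE c0 scale0r addr0.
have difg : differentiable g 0.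
  apply: differentiableD; first exact: differentiable_cst.
  exact: differentiableZl.
have difFg : differentiable (F \o g) 0.
  by apply: differentiable_comp => //; rewrite gx.
have -> : (fun t => F (x + c t *: d)) = F \o g by [].
split; first exact/derivable1_diffP.
rewrite deriveE // diff_comp ?gx //= diffD //; last exact: differentiableZl.
rewrite diff_cst diffZl //= add0r linearZ /=; congr (_ *: _).
by rewrite -deriveE // derive_val.
Qed.

Lemma differentiable_calA (R : realType) (n p : nat) (M : 'M[R]_n)
    (X : 'M[R]_(n, p)) : differentiable (calA M) X.
Proof.
apply: differentiable_mulmx; [exact: ex_diff|apply: differentiableB].
  exact: differentiable_cst.
apply: differentiableZ; apply: differentiable_mulmx => //.
apply: differentiable_mulmx; last exact: differentiable_cst.
exact: differentiable_trmx.
Qed.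

Lemma differentiable_penalty (R : realType) (n p : nat)
    (f : 'M[R]_(n, p) -> R) (M : 'M[R]_n) (beta : R) (X : 'M[R]_(n, p)) :
  (forall Y, differentiable f Y) -> differentiable (penalty f M beta) X.
Proof.
move=> df.
have dS : differentiable (fun Y : 'M[R]_(n, p) => Y^T *m M *m Y) X.
  apply: differentiable_mulmx => //.
  apply: differentiable_mulmx; last exact: differentiable_cst.
  exact: differentiable_trmx.
apply: differentiableD.
  exact: (differentiable_comp (differentiable_calA M X)).
apply: differentiableZ; apply: differentiable_mxtrace.
apply: differentiable_mulmx; [exact: ex_diff|apply: differentiableB].
  exact: differentiable_mulmx.
exact: differentiable_cst.
Qed.

(** In this section v is a unit left eigenvector of S, so V is a projector
    satisfying S V = V S = a V; every product below is expanded with these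
    rules. *)
Section Curve.
Variables (R : realType) (n p : nat) (M : 'M[R]_n) (X : 'M[R]_(n, p)).
Variables (a : R) (v : 'rV[R]_p).
Local Notation S := (X^T *m M *m X).
Local Notation V := (v^T *m v).
Hypothesis (symM : M^T = M) (vS : v *m S = a *: v) (v1 : frob_dot v v = 1).

Let vv1 : v *m v^T = 1%:M.
Proof. by rewrite [LHS]mx11_scalar -frob_dot_rV v1. Qed.

Let VV : V *m V = V.
Proof. by rewrite mulmxA -(mulmxA v^T) vv1 mulmx1. Qed.

Let VS : V *m S = a *: V.
Proof. by rewrite -mulmxA vS scalemxAr. Qed.

Let SV : S *m V = a *: V.
Proof.
have symS : S^T = S by rewrite !trmx_mul trmxK symM mulmxA.
apply: trmx_inj; have symV : V^T = V by rewrite trmx_mul trmxK.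
by rewrite trmx_mul symS linearZ /= symV VS.
Qed.

Let trV : \tr V = 1. Proof. exact: v1. Qed.

Lemma gram_curve (t : R) :
  (X + t *: (X *m V))^T *m M *m (X + t *: (X *m V)) =
  S + (2 * t + t ^+ 2) * a *: V.
Proof.
have -> : X + t *: (X *m V) = X *m (1%:M + t *: V).
  by rewrite mulmxDr mulmx1 scalemxAr.
have -> : (X *m (1%:M + t *: V))^T = (1%:M + t *: V) *m X^T.
  by rewrite trmx_mul linearD linearZ /= trmx1 trmx_mul trmxK.
transitivity ((1%:M + t *: V) *m S *m (1%:M + t *: V)).
  by rewrite !mulmxA.
rewrite mulmxDl mul1mx -scalemxAl VS mulmxDr mulmx1 mulmxDl.
rewrite -!scalemxAr -!scalemxAl SV VV !scalerA -!addrA -!(scalerDl V).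
by congr (_ + _ *: _); ring.
Qed.

Lemma gram_projection : (X *m V)^T *m M *m (X *m V) = a *: V.
Proof.
transitivity (V *m S *m V); first by rewrite !trmx_mul trmxK !mulmxA.
by rewrite VS -scalemxAl VV.
Qed.

Lemma calA_curve (t : R) :
  calA M (X + t *: (X *m V)) =
  calA M X +
    (t * (3 / 2) - a / 2 * (t + (1 + t) * (2 * t + t ^+ 2))) *: (X *m V).
Proof.
rewrite /calA gram_curve; set e := (2 * t + t ^+ 2).
rewrite scalerDr opprD addrA.
set B := (3 / 2)%:M - (1 / 2) *: S.
have VB : V *m B = (3 / 2 - a / 2) *: V.
  rewrite mulmxBr mul_mx_scalar -scalemxAr VS scalerA -scalerBl.
  by congr (_ *: _); ring.
rewrite mulmxDl mulmxBr -addrA; congr (_ + _).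
rewrite -scalemxAl -mulmxA mulmxBr VB -!scalemxAr VV !scalerA.
rewrite mulmxBr -!scalemxAr -(scalerBl _ _ (X *m V)) scalerA -scaleNr.
rewrite -(scalerDl (X *m V)).
by congr (_ *: _); ring.
Qed.

(** The additive term is g(a (1 + t)^2) - g(a) with g(y) = y^3 - 3 y: along the
    curve only the eigenvalue a of S varies, as a (1 + t)^2. *)
Lemma trace_curve (t : R) :
  let Y := X + t *: (X *m V) in
  \tr (Y^T *m M *m Y *m ((Y^T *m M *m Y) ^+ 2 - 3%:M)) =
  \tr (S *m (S ^+ 2 - 3%:M)) - (a ^+ 3 - 3 * a) +
  ((a * (1 + t) ^+ 2) ^+ 3 - 3 * (a * (1 + t) ^+ 2)).
Proof.
move=> Y; rewrite gram_curve; set e := (2 * t + t ^+ 2) * a.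
rewrite !expr2 -!mulmxE.
have -> : (S + e *: V) *m (S + e *: V) =
    S *m S + (2 * a * e + e ^+ 2) *: V.
  rewrite mulmxDl !mulmxDr -!scalemxAr -!scalemxAl SV VS VV !scalerA.
  by rewrite -!addrA -!(scalerDl V); congr (_ + _ *: _); ring.
set k := 2 * a * e + e ^+ 2.
have VSS : V *m (S *m S - 3%:M) = (a ^+ 2 - 3) *: V.
  rewrite mulmxBr (mulmxA V S) VS -scalemxAl VS mul_mx_scalar.
  by rewrite scalerA -scalerBl.
have SVV : (S + e *: V) *m V = (a + e) *: V.
  by rewrite mulmxDl SV -scalemxAl VV -scalerDl.
rewrite addrAC mulmxDr -scalemxAr SVV mulmxDl -scalemxAl VSS.
rewrite !mxtraceD !mxtraceZ trV /k /e; ring.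
Qed.

End Curve.

(** The derivative of the penalty function in the direction X v^T v, computed
    once through its gradient and once along the curve. *)
Lemma stationary_eigen (R : realType) (n p : nat) (f : 'M[R]_(n, p) -> R)
    (M : 'M[R]_n) (beta : R) (X : 'M[R]_(n, p)) (a : R) (v : 'rV[R]_p) :
  (forall Y, differentiable f Y) -> M^T = M ->
  grad (penalty f M beta) X = 0 ->
  v *m (X^T *m M *m X) = a *: v -> frob_dot v v = 1 ->
  (3 / 2) * (1 - a) * frob_dot (grad f (calA M X)) (X *m (v^T *m v)) +
    beta * (a ^+ 3 - a) = 0.
Proof.
move=> df symM hX vS v1; set D := X *m (v^T *m v).
have dh := differentiable_penalty M beta X df.
have hl : is_derive (0 : R) 1 (fun t => penalty f M beta (X + t *: D)) 0.
  apply: is_derive_eq (is_derive_curve D dh (is_derive_id _ _) erefl) _.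
  by rewrite diff_grad hX /frob_dot trmx0 mul0mx mxtrace0 scaler0.
pose c (t : R) := t * (3 / 2) - a / 2 * (t + (1 + t) * (2 * t + t ^+ 2)).
pose g (t : R) := beta / 6 *
  (\tr (X^T *m M *m X *m ((X^T *m M *m X) ^+ 2 - 3%:M)) - (a ^+ 3 - 3 * a) +
  ((a * (1 + t) ^+ 2) ^+ 3 - 3 * (a * (1 + t) ^+ 2))).
have dc : is_derive (0 : R) 1 c (3 / 2 * (1 - a)).
  rewrite /c; apply: is_derive_eq; rewrite /GRing.scale /=.
  by field.
have dg : is_derive (0 : R) 1 g (beta * (a ^+ 3 - a)).
  rewrite /g; apply: is_derive_eq; rewrite /GRing.scale /=.
  by field.
have c0 : c 0 = 0 by rewrite /c; ring.
have hr : is_derive (0 : R) 1 (fun t => penalty f M beta (X + t *: D))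
    (3 / 2 * (1 - a) * frob_dot (grad f (calA M X)) D + beta * (a ^+ 3 - a)).
  rewrite (_ : (fun t => _) = (fun t => f (calA M X + c t *: D)) + g).
    rewrite -diff_grad; apply: is_deriveD.
    exact: is_derive_curve (df _) dc c0.
  apply: funext => t; rewrite /penalty (calA_curve symM vS v1).
  by have /= -> := trace_curve symM vS v1 t.
by rewrite -(@derive_val _ _ _ _ _ _ _ hr) (@derive_val _ _ _ _ _ _ _ hl).
Qed.

(** * Norm estimates and the bound on the penalty parameter *)

Lemma psd_gram (R : realType) (n p : nat) (M : 'M[R]_n) (X : 'M[R]_(n, p)) :
  psd M -> psd (X^T *m M *m X).
Proof.
move=> psdM; split=> [|x].
  by rewrite !trmx_mul trmxK psdM.1 mulmxA.
by rewrite mulmxA frob_dot_mulmxr mulmxA; exact: psd_mx.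
Qed.

(** Trace form of s I <= M. *)
Lemma gram_trace_ge (R : realType) (n p : nat) (M : 'M[R]_n) (s : R)
    (Y : 'M[R]_(n, p)) :
  psd (M - s%:M) -> s * frob_norm Y ^+ 2 <= \tr (Y^T *m M *m Y).
Proof.
move=> /(psd_form_le Y^T); rewrite mul_mx_scalar frob_dotZr.
have -> : frob_dot Y^T Y^T = frob_norm Y ^+ 2.
  by rewrite sqr_frob_norm /frob_dot trmxK mxtrace_mulC.
by rewrite /frob_dot trmxK mxtrace_mulC.
Qed.

(** Tested on the identity matrix, the form of A is its trace. *)
Lemma mxtrace_le (R : realType) (p : nat) (A : 'M[R]_p) (a : R) :
  psd (a%:M - A) -> \tr A <= p%:R * a.
Proof.
move=> /(psd_form_le 1%:M); rewrite !mul1mx /frob_dot trmx1 !mul1mx.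
by rewrite mxtrace_scalar mulr_natl.
Qed.

(** Since |X S| <= a |X|, the norm of 3/2 X - 1/2 X S is at most
    (3 + a) / 2 |X|, and 3 + a <= 4 a. *)
Lemma calA_norm_le (R : realType) (n p : nat) (M : 'M[R]_n)
    (X : 'M[R]_(n, p)) (a : R) :
  1 <= a -> psd M -> psd (a%:M - X^T *m M *m X) ->
  frob_norm (calA M X) <= 2 * a * frob_norm X.
Proof.
move=> a1 psdM psdaS.
have a0 : 0 <= a by apply: le_trans a1.
have := psd_mulmx_le X a0 (psd_gram X psdM) psdaS.
rewrite /calA; set S := X^T *m M *m X => XS.
rewrite mulmxBr mul_mx_scalar -scalemxAr -scaleNr.
apply: (le_trans (frob_normD _ _)); rewrite !frob_normZ normrN.
rewrite !ger0_norm ?divr_ge0 //.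
have : 0 <= frob_norm X by exact: sqrtr_ge0.
by nra.
Qed.

(** The roles of the variables are r^2 = sigma_min M, q^2 = a, c = p, and x, g,
    d are the norms of X, of the gradient at A(X) and of the test direction.
    After multiplication by r^2, the estimates bound both sides of the
    stationarity equation by multiples of q^4, and q >= 1 absorbs the terms of
    lower degree. *)
Lemma penalty_bound_of_growth (R : realFieldType)
    (beta r q c x g d L0 L : R) :
  0 <= beta -> 0 < r -> 1 <= q -> 0 <= L0 -> 0 <= L -> 0 <= g -> 0 <= d ->
  r * x <= c * q -> r * d <= q -> g <= L0 + L * (2 * q ^+ 2 * x) ->
  beta * (q ^+ 2 * (q ^+ 2 + 1)) <= 3 / 2 * (g * d) ->
  beta * r ^+ 2 <= 3 / 2 * (r * L0 + 2 * c * L).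
Proof.
move=> b0 r_gt0 q1 L00 L_ge0 g0 d0 rx rd gL stat.
have r0 := ltW r_gt0.
have q0 : 0 <= q by apply: le_trans q1.
have rg : r * g <= q ^+ 3 * (r * L0 + 2 * c * L).
  have -> : q ^+ 3 * (r * L0 + 2 * c * L) =
      q ^+ 3 * (r * L0) + L * (2 * q ^+ 2 * (c * q)) by ring.
  apply: (@le_trans _ _ (r * L0 + L * (2 * q ^+ 2 * (r * x)))).
    have -> : r * L0 + L * (2 * q ^+ 2 * (r * x)) =
        r * (L0 + L * (2 * q ^+ 2 * x)) by ring.
    by rewrite ler_wpM2l.
  apply: lerD; first by rewrite ler_peMl ?exprn_ege1 // mulr_ge0.
  by do 2!rewrite ler_wpM2l // ?mulr_ge0 ?sqr_ge0 //.
have q4 : 0 < q ^+ 4 by rewrite exprn_gt0 //; apply: lt_le_trans q1.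
rewrite -(ler_pM2l q4).
have gd : (r * g) * (r * d) <= q ^+ 3 * (r * L0 + 2 * c * L) * q.
  by apply: ler_pM => //; rewrite mulr_ge0.
have rstat : r ^+ 2 * (beta * (q ^+ 2 * (q ^+ 2 + 1))) <=
    r ^+ 2 * (3 / 2 * (g * d)) by rewrite ler_wpM2l ?sqr_ge0.
have slack : 0 <= r ^+ 2 * beta * q ^+ 2.
  by rewrite mulr_ge0 ?sqr_ge0 // mulr_ge0 ?sqr_ge0.
lra.
Qed.

Theorem proposition3p7 (R : realType) (n p : nat)
  (hp : (1 <= p)%N) (hpn : (p <= n)%N)
  (k l : nat)
  (Xi : probability (k.-tuple R) R) (Theta : probability (l.-tuple R) R)
  (f_ : k.-tuple R -> 'M[R]_(n, p) -> R) (f : 'M[R]_(n, p) -> R)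
  (M_ : l.-tuple R -> 'M[R]_n) (M : 'M[R]_n)
  (hf : forall X, has_mean Xi (fun xi => f_ xi X) (f X))
  (hM : has_mean_mx Theta M_ M)
  (Lg : R)
  (hfdiff : forall X : 'M[R]_(n, p), differentiable f X)
  (hfLip : forall X Y,
     frob_norm (grad f X - grad f Y) <= Lg * frob_norm (X - Y))
  (hfxidiff : {ae Xi, forall xi,
     forall X : 'M[R]_(n, p), differentiable (f_ xi) X})
  (hfxigrad : forall X, has_mean_mx Xi (fun xi => grad (f_ xi) X) (grad f X))
  (hMspd : sym_posdef M)
  (beta betat : R) (hbeta : 0 < beta)
  (hbetat : betat >=
     12 * kappa M *
       (3 * (p + 1)%:R * Lg + Num.sqrt (sigma_min M) * frob_norm (grad f 0)) /
     sigma_min M)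
  (hbetabetat : betat < beta)
  (X : 'M[R]_(n, p))
  (hX : grad (penalty f M beta) X = 0) :
  sigma_max (X^T *m M *m X) <= 1.
Proof.
have n0 : (0 < n)%N by exact: leq_trans hp hpn.
have psdM := sym_posdef_psd hMspd; have [symM _] := hMspd.
have [sig_gt0 psdsM kap1] := sigma_min_posdef n0 hMspd.
set S := X^T *m M *m X.
have psdS : psd S by exact: psd_gram.
have [a [v [vS v1 psdaS]]] := max_eigenvector hp psdS.1.
suff a1 : a <= 1.
  have [S0|/set0P S0] := eqVneq (singular_values S) set0.
    by rewrite /sigma_max S0 sup0.
  apply: ge_sup S0 _ => s /(singular_value_eigen _ psdS)[_ [u uS u0]].
  apply: le_trans a1; rewrite -subr_ge0.
  apply: (psd_eigenvalue_ge0 psdaS _ u0).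
  by rewrite mulmxBr uS mul_mx_scalar -scalerBl.
rewrite leNgt; apply/negP => a_gt1.
have := stationary_eigen hfdiff symM hX vS v1.
set G := grad f _; set D := X *m _ => stat.
have {stat} stat : beta * (a * (a + 1)) = 3 / 2 * frob_dot G D.
  have a1_neq0 : a - 1 != 0 by rewrite subr_eq0 gt_eqF.
  apply: (mulfI a1_neq0); apply/eqP; rewrite -subr_eq0 -stat.
  by apply/eqP; ring.
(* The Lipschitz inequality on two distinct points forces Lg >= 0. *)
have Lg0 : 0 <= Lg.
  have := hfLip (delta_mx (Ordinal n0) (Ordinal hp)) 0; rewrite subr0.
  move=> /(le_trans (sqrtr_ge0 _)); rewrite pmulr_lge0 // sqrtr_gt0.
  apply: frob_dot_gt0; apply/eqP => /matrixP /(_ (Ordinal n0) (Ordinal hp)).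
  by rewrite !mxE !eqxx; apply/eqP; rewrite oner_eq0.
set sig := sigma_min M in sig_gt0 psdsM hbetat *.
set r := Num.sqrt sig in hbetat *; set L0 := frob_norm _ in hbetat *.
have r_gt0 : 0 < r by rewrite sqrtr_gt0.
have rE : sig = r ^+ 2 by rewrite sqr_sqrtr // ltW.
pose q := Num.sqrt a.
have a_gt0 : 0 < a by apply: lt_trans a_gt1.
have aE : a = q ^+ 2 by rewrite sqr_sqrtr // ltW.
have q1 : 1 <= q by rewrite -[leLHS]sqrtr1 ler_sqrt // ltW.
have q0 : 0 <= q by exact: sqrtr_ge0.
have r0 : 0 <= r by exact: sqrtr_ge0.
have p1 : 1 <= p%:R :> R by rewrite ler1n.
have rX : r * frob_norm X <= p%:R * q.
  have := le_trans (gram_trace_ge X psdsM) (mxtrace_le psdaS).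
  have := sqrtr_ge0 (frob_dot X X); rewrite -/(frob_norm X) rE aE => X0 h.
  rewrite -(ler_pXn2r (n := 2)) ?nnegrE ?mulr_ge0 //.
  (* p <= p^2 avoids a square root of p. *)
  rewrite !exprMn; apply: (le_trans h); rewrite ler_wpM2r ?sqr_ge0 //.
  by rewrite expr2 ler_peMl.
have rD : r * frob_norm D <= q.
  have := gram_trace_ge D psdsM.
  have -> : \tr (D^T *m M *m D) = a.
    by rewrite (gram_projection vS v1) mxtraceZ [\tr _]v1 mulr1.
  have := sqrtr_ge0 (frob_dot D D); rewrite -/(frob_norm D) rE aE => D0 h.
  rewrite -(ler_pXn2r (n := 2)) ?nnegrE ?mulr_ge0 //.
  by rewrite exprMn.
have GL : frob_norm G <= L0 + Lg * (2 * a * frob_norm X).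
  rewrite -[G](subrK (grad f 0)) addrC; apply: (le_trans (frob_normD _ _)).
  rewrite lerD2l; apply: le_trans (hfLip _ _) _; rewrite subr0.
  by apply: ler_wpM2l => //; apply: calA_norm_le => //; exact: ltW.
have cs := frob_cauchy_schwarz G D.
have L00 : 0 <= L0 by exact: sqrtr_ge0.
have G0 : 0 <= frob_norm G by exact: sqrtr_ge0.
have D0 : 0 <= frob_norm D by exact: sqrtr_ge0.
have key : beta * sig <= 3 / 2 * (r * L0 + 2 * p%:R * Lg).
  rewrite rE; apply: (penalty_bound_of_growth (ltW hbeta) r_gt0 q1 L00 Lg0 G0 D0
    rX rD); rewrite -aE // stat.
  by rewrite ler_wpM2l.
move: (le_lt_trans hbetat hbetabetat); rewrite ltr_pdivrMr // => bb.
have pLg0 : 0 <= p%:R * Lg by rewrite mulr_ge0.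
have rL0 : 0 <= r * L0 := mulr_ge0 r0 L00.
have W0 : 0 <= 3 * (p + 1)%:R * Lg + r * L0.
  apply: addr_ge0 rL0; apply: mulr_ge0 Lg0.
  exact: mulr_ge0 (ler0n _ _) (ler0n _ _).
have kapW := ler_wpM2r W0 (ler_peMr (ler0n R 12) kap1).
by move: bb kapW; rewrite natrD; lra.
Qed.
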